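(* Let $\theta\ge 1$, $m\ge 1$, $\Theta=\{1,\dots,\theta\}$, and let $(\mu_l^t)_{l\ge 0,\,t\in\Theta}$ be arbitrary probability measures on $\mathbb{N}^\theta$. Let $k_0\ge 0$ and $k\ge 1$ be integers with $k_0\le k$. Let $A_{k_0}^{(1)},\dots,A_{k_0}^{(m)}$ be an arbitrary partition of $\mathcal{T}_{k_0}$ (classes may be empty) and, for each $k_0<l\le k$, let $B_{l,1},\dots,B_{l,m}$ be an arbitrary partition of $\mathbb{N}^{m\times\theta}$ (parts may be empty). Let the Galton-Watson measures $P_{lk}^t$ and the measures $\tilde P_{lk}^t$ be defined from these data as in the context. Then for all $0\le l\le k-k_0$, all $t\in\Theta$ and all $T\in\mathcal{T}_{k-l}^t$, $$P_{lk}^t(T)=\tilde P_{lk}^t(T).$$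
   Context: Here $\mathbb{N}=\{0,1,2,\dots\}$, and empty products equal $1$. **Trees.** Let $\mathcal{T}_0=\{\mathbf{1},\dots,\boldsymbol{\theta}\}$, where $\mathbf{t}$ denotes the tree consisting only of a root of type $t$ (no children). For $k\ge1$, inductively, $$\mathcal{T}_k=\mathcal{T}_0\sqcup\bigsqcup_{n=1}^\infty\{(t,[T_1,\dots,T_n]) : T_i\in\mathcal{T}_{k-1},\ t\in\Theta\},$$ where $[T_1,\dots,T_n]$ is an ordered list. This is the set of (finite, ordered, typed) trees of height at most $k$. Put $\mathcal{T}=\bigcup_k\mathcal{T}_k$. For $T=(t,[T_1,\dots,T_n])$ the trees $T_1,\dots,T_n$ are the children of $T$, written $T_i\prec T$; the children are counted with multiplicity (by position in the list) in all counts and products over $\tilde T\prec T$. The type $r(T)$ is the type of the root. Let $\mathcal{T}^t=\{T\in\mathcal{T}: r(T)=t\}$ and $\mathcal{T}_k^t=\mathcal{T}_k\cap\mathcal{T}^t$. Let $N(T)=(N_1(T),\dots,N_\theta(T))\in\mathbb{N}^\theta$, where $N_s(T)$ is the number of children of $T$ of type $s$. For a finite family $\mathbf{x}$ of nonnegative integers (a vector or a matrix), $D(\mathbf{x})=\dfrac{(\sum_i x_i)!}{\prod_i x_i!}$ is the multinomial coefficient, with sum and product over all entries. **Galton-Watson measures.** Let $W_l^t\sim\mu_l^t$ be independent random vectors in $\mathbb{N}^\theta$ (the offspring vector of a type $t$ node at level $l$), with coordinates $W_{l,j}^t$. Let $P_{kk}^t$ be the probability measure on $\mathcal{T}_0^t=\{\mathbf{t}\}$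 with $P_{kk}^t(\mathbf{t})=1$. For $0\le l<k$, $P_{lk}^t$ is the probability measure on $\mathcal{T}_{k-l}^t$ defined inductively by $$P_{lk}^t(T)=\frac{\mathbb{P}(W_l^t=N(T))}{D(N(T))}\prod_{\tilde T\prec T}P_{l+1,k}^{r(\tilde T)}(\tilde T).$$ **Recursive partitions.** Starting from the partition $A_{k_0}^{(1)},\dots,A_{k_0}^{(m)}$ of $\mathcal{T}_{k_0}$, define for $k_0<l\le k$, recursively, the counting matrix $C_l:\mathcal{T}_l\to\mathbb{N}^{m\times\theta}$ by $$C_l^{(i,j)}(T)=\#\{\tilde T\prec T:\tilde T\in A_{l-1}^{(i)}\cap\mathcal{T}^j\},$$ and then $A_l^{(i)}=\{T\in\mathcal{T}_l: C_l(T)\in B_{l,i}\}$ for $i=1,\dots,m$. This gives a partition of $\mathcal{T}_l$. **The measures $\tilde P$.** For $0\le l\le k-k_0$ put ${}^tp_{lk}^{(i)}=P_{lk}^t(A_{k-l}^{(i)}\cap\mathcal{T}^t)$. For $q\in[0,1]^m$ with $\sum_i q_i=1$, let $\mathrm{Multi}(n,q)$ denote the multinomial distribution on $\mathbb{N}^m$ of $n$ elements distributed over $m$ classes with probabilities $q_i$. For $0\le l\le k-k_0-1$ let ${}^tX_{lk}=({}^tX_{lk}^{(i,j)})$ be a random matrix in $\mathbb{N}^{m\times\theta}$, on the same probability space as $W_l^t$, such that conditionally on $W_l^t$ its columns are independent and the $j$th column has law $\mathrm{Multi}\big(W_{l,j}^t,({}^jp_{l+1,k}^{(1)},\dots,{}^jp_{l+1,k}^{(m)})\big)$.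 For $l=k-k_0$ and $T\in\mathcal{T}_{k_0}^t$ define $${}^t\tilde Q_{k-k_0,k}^{(i)}(T)=\frac{P_{k-k_0,k}^t(T)}{P_{k-k_0,k}^t(A_{k_0}^{(i)}\cap\mathcal{T}^t)}\ \text{ if } T\in A_{k_0}^{(i)},\qquad {}^t\tilde Q_{k-k_0,k}^{(i)}(T)=0\ \text{ if } T\notin A_{k_0}^{(i)}.$$ For $0\le l\le k-k_0-1$ and $T\in\mathcal{T}_{k-l}^t$ define inductively $${}^t\tilde Q_{lk}^{(i)}(T)=\frac{\mathbb{P}\big({}^tX_{lk}=C_{k-l}(T)\,\big|\,{}^tX_{lk}\in B_{k-l,i}\big)}{D(C_{k-l}(T))}\prod_{j=1}^m\ \prod_{\tilde T\prec T:\ \tilde T\in A_{k-l-1}^{(j)}}{}^{r(\tilde T)}\tilde Q_{l+1,k}^{(j)}(\tilde T).$$ Convention: a conditional probability given a null event, or a quotient with denominator $0$, is taken to be $0$. Finally, for $0\le l\le k-k_0$ and $T\in\mathcal{T}_{k-l}^t$, $$\tilde P_{lk}^t(T)=\sum_{i=1}^m{}^tp_{lk}^{(i)}\;{}^t\tilde Q_{lk}^{(i)}(T).$$ *)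

(* Defs.v *)
From HB Require Import structures.
From mathcomp Require Export all_boot all_order all_algebra finmap.
From mathcomp Require Export all_classical all_reals all_analysis.
#[export] Set Implicit Arguments.
#[export] Unset Strict Implicit.
#[export] Unset Printing Implicit Defensive.
Export Order.TTheory GRing.Theory Num.Theory.
#[global] Open Scope classical_set_scope.
#[global] Open Scope ring_scope.

(* The types {1, ..., theta} are represented by 'I_theta. *)
Inductive tree (theta : nat) : Type :=
  Node : 'I_theta -> seq (tree theta) -> tree theta.

Definition root_type theta (T : tree theta) : 'I_theta := let: Node t _ := T in t.

Definition children theta (T : tree theta) : seq (tree theta) :=
  let: Node _ ts := T in ts.

Section TreeCountable.
Variable theta : nat.

Lemma tree_nested_ind (P : tree theta -> Prop) :
  (forall t ts, foldr (fun T Q => P T /\ Q) True ts -> P (Node t ts)) ->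
  forall T, P T.
Proof.
move=> PN; fix IH 1 => -[t ts]; apply: PN.
by elim: ts => [//|T ts IHts]; split.
Qed.

Fixpoint tree_encode (T : tree theta) : GenTree.tree void :=
  let: Node t ts := T in GenTree.Node (val t) (map tree_encode ts).

Fixpoint tree_decode (g : GenTree.tree void) : option (tree theta) :=
  if g is GenTree.Node n gs then
    omap (fun t => Node t (pmap tree_decode gs)) (insub n)
  else None.

Lemma tree_encodeK : pcancel tree_encode tree_decode.
Proof.
elim/tree_nested_ind => t ts IH /=; rewrite valK /=; congr (Some (Node t _)).
elim: ts IH => [//|T ts IHts] /= [-> IH] /=.
by rewrite IHts.
Qed.

HB.instance Definition _ := Countable.copy (tree theta) (pcan_type tree_encodeK).
End TreeCountable.

(* N^theta and N^(m x theta) carry the discrete sigma-algebra. *)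
HB.instance Definition _ (a b : nat) :=
  @isMeasurable.Build default_measure_display 'M[nat]_(a, b)
    discrete_measurable discrete_measurable0
    discrete_measurableC discrete_measurableU.

(* Unlike [partition] of the library, the parts may be empty. *)
Definition is_partition (U : Type) (I : Type) (A : I -> set U) (S : set U) : Prop :=
  trivIset [set: I] A /\ \bigcup_i A i = S.

Fixpoint trees_le (theta k : nat) : set (tree theta) :=
  if k is k'.+1 then
    [set T | exists t, T = Node t [::]] `|`
    [set T | exists t ts, [/\ ts <> [::], {in ts, forall T', trees_le k' T'}
                            & T = Node t ts]]
  else [set T | exists t, T = Node t [::]].

Definition trees_of_type (theta : nat) (t : 'I_theta) : set (tree theta) :=
  [set T | root_type T = t].

Definition offspring (theta : nat) (T : tree theta) : 'rV[nat]_theta :=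
  \row_s count (fun T' => root_type T' == s) (children T).

Definition multinomial_coef (R : realType) a b (x : 'M[nat]_(a, b)) : R :=
  ((\sum_i \sum_j x i j)%N`!)%:R / (\prod_i \prod_j (x i j)`!)%N%:R.

(* Mass function of the multinomial distribution Multi(n, q). *)
Definition multinomial_pmf (R : realType) (m n : nat) (q : 'I_m -> R)
    (y : 'cV[nat]_m) : R :=
  if (\sum_i y i ord0)%N == n
  then multinomial_coef R y * \prod_i q i ^+ y i ord0 else 0.

Section Probability.
Context (R : realType) (d : measure_display) (Omega : measurableType d).
Variable Pr : probability Omega R.

Definition prob (E : set Omega) : R := fine (Pr E).

(* Since 0^-1 = 0, this is 0 when F is a null event. *)
Definition cprob (E F : set Omega) : R := prob (E `&` F) / prob F.

(* Independence, under the set function Q, of a family of variables valued in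
   discrete spaces (so that every set S i is measurable). *)
Definition mutually_independent (Q : set Omega -> R) (I : choiceType) (U : Type)
    (Y : I -> Omega -> U) : Prop :=
  forall (J : {fset I}) (S : I -> set U),
    Q (\bigcap_(i in [set` J]) Y i @^-1` S i) = \prod_(i <- J) Q (Y i @^-1` S i).

(* Conditionally on W, the columns of X are independent and the j-th one has
   law Multi(W_j, q j). *)
Definition cond_multinomial_columns (m theta : nat)
    (W : Omega -> 'rV[nat]_theta) (X : Omega -> 'M[nat]_(m, theta))
    (q : 'I_theta -> 'I_m -> R) : Prop :=
  forall w : 'rV[nat]_theta, prob (W @^-1` [set w]) != 0 ->
    let Q := fun E => cprob E (W @^-1` [set w]) in
    mutually_independent Q (fun (j : 'I_theta) om => col j (X om)) /\
    forall (j : 'I_theta) (y : 'cV[nat]_m),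
      Q [set om | col j (X om) = y] = multinomial_pmf (w ord0 j) (q j) y.
End Probability.

Section RecursivePartition.
Variables (theta m k0 : nat) (A : 'I_m -> set (tree theta)).
Variable B : nat -> 'I_m -> set 'M[nat]_(m, theta).

Definition count_mx (A' : 'I_m -> set (tree theta)) (T : tree theta) :
    'M[nat]_(m, theta) :=
  \matrix_(i, j) count (fun T' => T' \in A' i `&` trees_of_type j) (children T).

(* cell_rec n is the partition of the trees of height at most k0 + n. *)
Fixpoint cell_rec (n : nat) : 'I_m -> set (tree theta) :=
  if n is n'.+1 then
    fun i => [set T | trees_le (k0 + n) T /\ B (k0 + n) i (count_mx (cell_rec n') T)]
  else A.

(* A_l^(i) and C_l, meaningful for k0 <= l and k0 < l respectively. *)
Definition cell (l : nat) : 'I_m -> set (tree theta) := cell_rec (l - k0).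

Definition counting (l : nat) (T : tree theta) : 'M[nat]_(m, theta) :=
  count_mx (cell l.-1) T.
End RecursivePartition.

Section GaltonWatson.
Context (R : realType) (theta : nat) (d : measure_display).
Context (Omega : measurableType d).
Variables (Pr : probability Omega R) (W : nat -> 'I_theta -> Omega -> 'rV[nat]_theta).

(* gw_rec n l t = P_{l,l+n}^t, extended by 0 to all trees. *)
Fixpoint gw_rec (n l : nat) (t : 'I_theta) (T : tree theta) : R :=
  if n is n'.+1 then
    if root_type T == t then
      prob Pr (W l t @^-1` [set offspring T]) / multinomial_coef R (offspring T)
      * \prod_(T' <- children T) gw_rec n' l.+1 (root_type T') T'
    else 0
  else if T == Node t [::] then 1 else 0.

Definition gw (l k : nat) (t : 'I_theta) (T : tree theta) : R := gw_rec (k - l) l t T.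

(* The mass that P_{lk}^t gives to a set of trees. *)
Definition gw_measure (l k : nat) (t : 'I_theta) (S : set (tree theta)) : R :=
  fine (\esum_(T in S) (gw l k t T)%:E).

Variables (m k0 k : nat) (A : 'I_m -> set (tree theta)).
Variable B : nat -> 'I_m -> set 'M[nat]_(m, theta).

Definition cell_prob (l : nat) (t : 'I_theta) (i : 'I_m) : R :=
  gw_measure l k t (cell k0 A B (k - l) i `&` trees_of_type t).

Variable X : nat -> 'I_theta -> Omega -> 'M[nat]_(m, theta).

(* n = k - k0 - l; the value is meaningful for T of type t and height at most
   k - l. *)
Fixpoint tildeQ_rec (n l : nat) (t : 'I_theta) (i : 'I_m) (T : tree theta) : R :=
  if n is n'.+1 then
    let C := counting k0 A B (k - l) T in
    cprob Pr (X l t @^-1` [set C]) (X l t @^-1` B (k - l) i)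
    / multinomial_coef R C
    * \prod_(j < m) \prod_(T' <- children T | T' \in cell k0 A B (k - l).-1 j)
        tildeQ_rec n' l.+1 (root_type T') j T'
  else if T \in A i then gw l k t T / gw_measure l k t (A i `&` trees_of_type t)
  else 0.

Definition tildeQ (l : nat) (t : 'I_theta) (i : 'I_m) (T : tree theta) : R :=
  tildeQ_rec (k - k0 - l) l t i T.

Definition tildeP (l : nat) (t : 'I_theta) (T : tree theta) : R :=
  \sum_(i < m) cell_prob l t i * tildeQ l t i T.
End GaltonWatson.

(* Main.v *)
From mathcomp Require Import ring zify.
Require Import Defs.

(* Let p_a be the mass, under the subtree measures, of the class a of trees that
   have a given root type and lie in a given cell.  Summing the product weights
   over all lists of trees with c_a entries in class a gives
   D(c) prod_a p_a^(c_a), where D is the multinomial coefficient.  Hence the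
   counting matrix of a Galton-Watson tree is distributed like X, and the cell i
   has mass P(X in B_i).  In p_i P(X = C | X in B_i) the conditioning then
   cancels, leaving P(X = C) = P(W = N) prod_j D(C_j) prod_a p_a^(C_a), where C_j
   is the jth column of C.  The factors p_a recombine with the conditional
   measures of the children by induction on the height, and D(C) against the
   D(C_j) leaves exactly 1 / D(N).  The masses are finite because applying the
   same computation to the classes given by the root type alone bounds the total
   mass of a Galton-Watson measure by 1. *)

(** * Sums over lists of trees with prescribed class counts *)

Local Open Scope ereal_scope.

Lemma esumZl (R : realType) (T : choiceType) (I : set T) (c : R) (a : T -> \bar R) :
  (0 <= c)%R -> (forall i, 0 <= a i) ->
  \esum_(i in I) (c%:E * a i) = c%:E * \esum_(i in I) a i.
Proof.
(* Stated for every scalar and family, because the converse inequality is this one at $c^{-1}$ and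
   the family $c\,a$. *)
have le_half (r : R) (b : T -> \bar R) : (0 <= r)%R -> (forall i, 0 <= b i) ->
    \esum_(i in I) (r%:E * b i) <= r%:E * \esum_(i in I) b i.
  move=> r0 b0; rewrite ge_ereal_sup => //= _ [F [finF FI] <-].
  rewrite -ge0_mule_fsumr// lee_wpmul2l ?lee_fin//.
  by apply: esum_ge; exists F.
move=> c0 a0; apply/eqP; rewrite eq_le le_half//=.
have [<-|/eqP cN0] := 0%R =P c; first by rewrite mul0e esum_ge0// => i _; rewrite mul0e.
have {cN0}c0 : (0 < c)%R by rewrite lt_neqAle cN0.
rewrite -lee_pdivlMl//; have ca0 i : 0 <= c%:E * a i.
  by apply: mule_ge0 => //; rewrite lee_fin ltW.
have cV0 : (0 <= c^-1)%R by rewrite invr_ge0 ltW.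
apply: le_trans (le_half _ _ cV0 ca0).
by apply: le_esum => i _; rewrite muleA -EFinM mulVf ?mul1e// gt_eqF.
Qed.

Lemma le_esum_subset (R : realType) (T : choiceType) (D E : set T)
    (a : T -> \bar R) :
  D `<=` E -> (forall x, 0 <= a x) ->
  \esum_(x in D) a x <= \esum_(x in E) a x.
Proof.
move=> DE a0; rewrite esum_mkcond [leRHS]esum_mkcond; apply: le_esum => x _.
by case: ifPn => [/set_mem/DE/mem_set->//|_]; case: ifP.
Qed.

Lemma esum_fin (R : realType) (K : finType) (I : set K) (a : K -> \bar R) :
  (forall i, I i -> 0 <= a i) ->
  \esum_(i in I) a i = \sum_(i | i \in I) a i.
Proof.
move=> a0; rewrite esum_mkcond esum_fset ?fsbig_finite//=.
- rewrite [RHS]big_mkcond; apply: perm_big.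
  apply: uniq_perm; rewrite ?fset_uniq ?index_enum_uniq//.
  move=> i; rewrite mem_index_enum in_fset_set; last exact: finite_finset.
  exact/mem_set.
- by move=> i _; case: ifPn => // /set_mem/a0.
Qed.

(** Reindexing by the graph $x\mapsto(f(x),x)$ turns the single sum into the iterated one. *)
Lemma esum_fibers (R : realType) (T K : choiceType) (f : T -> K) (D : set T)
    (S : set K) (a : T -> \bar R) : (forall x, D x -> 0 <= a x) ->
  \esum_(x in D `&` f @^-1` S) a x
  = \esum_(y in S) \esum_(x in D `&` f @^-1` [set y]) a x.
Proof.
move=> a0; rewrite esum_esum; last by move=> y x _ [/a0].
rewrite (reindex_esum (D `&` f @^-1` S) _ (fun x => (f x, x)))//; split.
- by move=> x [Dx Sfx].
- by move=> x y _ _ [].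
- by move=> [y x] /= [] /[swap] -[Dx <-] Sy; exists x.
Qed.

(** Countable additivity over the fibres of [Y], enumerated by the codes of their values in the
    countable type [K]. *)
Lemma measure_preimage_esum (R : realType) d (Omega : measurableType d)
    (mu : measure Omega R) (K : countType) (Y : Omega -> K) (E : set Omega) (S : set K) :
  measurable E -> (forall c, measurable (Y @^-1` [set c])) ->
  mu (E `&` Y @^-1` S) = \esum_(c in S) mu (E `&` Y @^-1` [set c]).
Proof.
move=> mE mY.
pose G n := if @choice.unpickle K n is Some c then E `&` Y @^-1` [set c] else set0.
have -> : E `&` Y @^-1` S = \bigcup_(n in choice.pickle @` S) G n.
  apply/seteqP; split => [w [Ew Sw]|w [_ [c Sc <-]]].
    by exists (choice.pickle (Y w)); [exists (Y w)|rewrite /G choice.pickleK].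
  by rewrite /G choice.pickleK => -[Ew /= ->].
rewrite measure_bigcup.
- rewrite nneseries_esum// set_mem_set esum_image.
    by apply: eq_esum => c _; rewrite /G choice.pickleK.
  by move=> x y _ _ xy; apply: (pcan_inj (@choice.pickleK K)); exact: xy.
- by move=> _ [c Sc <-]; rewrite /G choice.pickleK; exact: measurableI.
- apply/trivIsetP => _ _ [c _ <-] [c' _ <-] cc'; rewrite /G !choice.pickleK.
  apply/seteqP; split => // w [[_ /= Yc] [_ /= Yc']].
  by move: cc'; rewrite -Yc -Yc' eqxx.
Qed.

Local Close Scope ereal_scope.

(** Requiring every entry to lie in some class makes the counts exhaust the list: for disjoint
    classes its length is $\sum_a c_a$. *)
Definition lists_of_class_count (U : choiceType) (K : finType) (V : K -> set U)
    (c : K -> nat) : set (seq U) :=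
  [set s : seq U | {in s, forall u, exists a, V a u} /\
           forall a, count (fun u => u \in V a) s = c a].

Section ListsOfClassCount.
Context (R : realType) (U : choiceType) (K : finType).
Variable V : K -> set U.
Hypothesis Vtriv : trivIset [set: K] V.

Lemma class_unique a b u : V a u -> V b u -> a = b.
Proof. by move=> Va Vb; apply: Vtriv => //; exists u. Qed.

Lemma mem_class a b u : V a u -> (u \in V b) = (b == a).
Proof.
move=> Va; apply/idP/eqP => [/set_mem Vb|->]; last exact/mem_set.
exact: class_unique Vb Va.
Qed.

(** The condition [0 < c a] guards the truncated subtraction on natural numbers. *)
Lemma cons_lists_of_class_count c a u s : V a u ->
  lists_of_class_count V c (u :: s) <->
  ((0 < c a)%N /\ lists_of_class_count V (fun b => c b - (b == a))%N s).
Proof.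
move=> Va; split => [[su cs]|[ca [su cs]]].
  have ca : (0 < c a)%N by rewrite -cs /= (mem_class _ Va) eqxx.
  split=> //; split => [v sv|b]; first by apply: su; rewrite inE sv orbT.
  by rewrite -cs /= (mem_class _ Va) addKn.
split=> [v|b /=].
  by rewrite inE => /orP[/eqP->|/su]//; exists a.
rewrite cs (mem_class _ Va); case: eqP => [->|_]; first by rewrite subnKC.
by rewrite subn0.
Qed.

(** Induction on the length $\sum_a c_a$. A head of class $a$ contributes $p_a$ and lowers the count
    of $a$ by one. The resulting terms are $c_a$ times a common factor, and $\sum_a c_a=n+1$ turns
    $n!$ into $(n+1)!$. *)
Lemma esum_lists_of_class_count (g : U -> R) (p : K -> R) (c : K -> nat) :
  (forall u, 0 <= g u) ->
  (forall a, \esum_(u in V a) (g u)%:E = (p a)%:E)%E ->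
  (\esum_(s in lists_of_class_count V c) (\prod_(u <- s) g u)%:E =
   ((\sum_a c a)`!%:R / (\prod_a (c a)`!)%:R * \prod_a p a ^+ c a)%:E)%E.
Proof.
move=> g0 pE; move cn : (\sum_a c a)%N => n.
elim: n c cn => [|n IH] c cn.
  have c0 a : c a = 0%N by move: cn; apply: contra_eq => ca;
    rewrite (bigD1 a)//= addn_eq0 negb_and ca.
  rewrite (_ : lists_of_class_count V c = [set [::]]); last first.
    apply/seteqP; split => [[|u s] [su cs]//|_ ->]; last by split => // a; rewrite c0.
    have [a Va] := su u (mem_head _ _).
    by move: (cs a); rewrite c0 /= (mem_class _ Va) eqxx.
  rewrite esum_set1 ?big_nil// !big1 ?fact0 ?divr1 ?mulr1//.
  - by move=> a _; rewrite c0 ?expr0.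
  - by move=> a _; rewrite c0 ?expr0.
pose dec a b := (c b - (b == a))%N.
(* A nonempty list is coded by the class of its head, the head and the tail. *)
pose P := [set a | (0 < c a)%N] `*``
  (fun a => V a `*`` (fun _ : U => lists_of_class_count V (dec a))).
have prod_ge0 (s : seq U) : (0 <= (\prod_(u <- s) g u)%:E)%E.
  by rewrite lee_fin prodr_ge0.
rewrite (reindex_esum P _ (fun x => x.2.1 :: x.2.2)); last first.
  split.
  - by move=> [a [u s]] [/= ca [/= Va cs]]; apply/(cons_lists_of_class_count _ _ Va).
  - move=> [a [u s]] [b [v s']] /set_mem[/= _ [/= Va _]] /set_mem[/= _ [/= Vb _]] [uv ->].
    by rewrite uv in Va *; rewrite (class_unique Va Vb).
  - move=> [|u s] cs.
      by move: cn; rewrite big1// => a _; case: cs => _ /(_ a).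
    have [a Va] := cs.1 u (mem_head _ _).
    have [ca cs'] := (cons_lists_of_class_count _ _ Va).1 cs.
    by exists (a, (u, s)).
under eq_esum do rewrite big_cons EFinM.
rewrite -(esum_esum (a := fun a us => (g us.1)%:E * (\prod_(u <- us.2) g u)%:E)%E); last first.
by move=> a us _ _; apply: mule_ge0 => //; rewrite lee_fin//.
pose rhs := \prod_a p a ^+ c a.
have p0 a : 0 <= p a by rewrite -lee_fin -pE; apply: esum_ge0 => u _; rewrite lee_fin.
transitivity (\esum_(a in [set a | (0 < c a)%N])
  (n`!%:R * (c a)%:R / (\prod_b (c b)`!)%:R * rhs)%:E)%E.
  apply: eq_esum => a /= ca.
  have dn : (\sum_b dec a b = n)%N.
    apply: succn_inj; rewrite -cn (bigD1 a)//= [RHS](bigD1 a)//= /dec eqxx.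
    rewrite -addSn subn1 prednK//; congr addn; apply: eq_bigr => b /negPf->.
    by rewrite subn0.
  rewrite -(esum_esum (a := fun u s => (g u)%:E * (\prod_(u <- s) g u)%:E)%E); last first.
    by move=> u s _ _; apply: mule_ge0 => //; rewrite lee_fin//.
  under eq_esum do rewrite esumZl// (IH _ dn) muleC.
  rewrite esumZl; first last.
  - by move=> u; rewrite lee_fin.
  - by rewrite mulr_ge0 ?divr_ge0// prodr_ge0// => b _; rewrite exprn_ge0.
  rewrite pE -EFinM; congr EFin.
  rewrite /rhs natr_prod [in RHS]natr_prod [\prod_b p b ^+ c b](bigD1 a)//=.
  rewrite [\prod_b _%:R in RHS](bigD1 a)//= [\prod_b _%:R in LHS](bigD1 a)//=.
  rewrite [\prod_b _ ^+ dec a b](bigD1 a)//= /dec eqxx subn1.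
  rewrite (eq_bigr (fun b => (c b)`!%:R)); last by move=> b /negPf->; rewrite subn0.
  rewrite [\prod_(b | b != a) p b ^+ _](eq_bigr (fun b => p b ^+ c b)); last first.
    by move=> b /negPf->; rewrite subn0.
  (* Exposing $c_a$ as a successor allows $c_a!=c_a(c_a-1)!$ and $p_a^{c_a}=p_a\,p_a^{c_a-1}$ to be
     unfolded. *)
  rewrite -{3 4 5}(prednK ca) factS exprS natrM.
  rewrite (prednK ca).
  have ca0 : (c a)%:R != 0 :> R by rewrite pnatr_eq0 -lt0n.
  have fa0 : ((c a).-1)`!%:R != 0 :> R by rewrite pnatr_eq0 -lt0n fact_gt0.
  have fb0 : \prod_(b | b != a) (c b)`!%:R != 0 :> R.
    by apply/prodf_neq0 => b _; rewrite pnatr_eq0 -lt0n fact_gt0.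
  by field; rewrite ca0 fa0 fb0.
rewrite esum_fin; last first.
  move=> a _; rewrite lee_fin !mulr_ge0 ?invr_ge0//.
  by rewrite prodr_ge0// => b _; rewrite exprn_ge0.
rewrite sumEFin; congr EFin.
rewrite -mulr_suml; congr (_ * _); rewrite -mulr_suml; congr (_ / _).
rewrite -mulr_sumr factS natrM mulrC -cn natr_sum; congr (_ * _).
(* Classes with $c_a=0$ are absent from the index set and add nothing to $\sum_a c_a$. *)
rewrite big_mkcond; apply: eq_bigr => a _.
by case: ifPn => //; rewrite notin_setE /= => /negP; rewrite -eqn0Ngt => /eqP->.
Qed.

End ListsOfClassCount.

(** * Total mass of the Galton-Watson measures *)

Lemma trees_le_Node theta n (t : 'I_theta) ts :
  trees_le n.+1 (Node t ts) <-> {in ts, forall T, trees_le n T}.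
Proof.
split => [[[_ [_ ->]]//|[_ [_ [_ le_ts [_ ->]]]]//]|le_ts].
by case: ts le_ts => [|T ts] le_ts; [left; exists t|right; exists t, (T :: ts)].
Qed.

Lemma mem_trees_of_type theta (s : 'I_theta) T :
  (T \in trees_of_type s) = (root_type T == s).
Proof. by apply/idP/eqP => [/set_mem|?]; last exact/mem_set. Qed.

(** Each entry lies in exactly one class, and its class fixes its root type through [tau], so the
    counts of the classes over one type add up. *)
Lemma count_root_type theta (K : finType) (V : K -> set (tree theta))
    (tau : K -> 'I_theta) (c : K -> nat) ts (s : 'I_theta) :
  trivIset [set: K] V -> (forall a T, V a T -> root_type T = tau a) ->
  lists_of_class_count V c ts ->
  count (fun T => root_type T == s) ts = (\sum_(a | tau a == s) c a)%N.
Proof.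
move=> Vtriv Vtau; elim: ts c => [|T ts IH] c cts.
  by rewrite big1// => a _; rewrite -(cts.2 a).
have [a Va] := cts.1 T (mem_head _ _).
have [ca cts'] := (cons_lists_of_class_count Vtriv _ _ Va).1 cts.
rewrite /= (IH _ cts') (Vtau _ _ Va).
case: eqP => [<-|tas].
  rewrite (bigD1 a)//= eqxx [RHS](bigD1 a)//= addnA subnKC//; congr addn.
  by apply: eq_bigr => b /andP[_ /negPf->]; rewrite subn0.
apply: eq_bigr => b /eqP tb; case: eqP => [ba|_]; last by rewrite subn0.
by case: tas; rewrite -ba.
Qed.

Lemma multinomial_coef_row (R : realType) n (w : 'rV[nat]_n) :
  multinomial_coef R w = (\sum_s w ord0 s)`!%:R / (\prod_s (w ord0 s)`!)%:R.
Proof. by rewrite /multinomial_coef !big_ord1. Qed.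

Lemma natr_fact_neq0 (R : realType) n : n`!%:R != 0 :> R.
Proof. by rewrite pnatr_eq0 -lt0n fact_gt0. Qed.

Lemma natr_prod_fact_neq0 (R : realType) (K : finType) (c : K -> nat) :
  (\prod_a (c a)`!)%:R != 0 :> R.
Proof. by rewrite natr_prod; apply/prodf_neq0 => a _; exact: natr_fact_neq0. Qed.

Section GaltonWatsonMass.
Context (R : realType) (theta : nat) (d : measure_display).
Context (Omega : measurableType d) (Pr : probability Omega R).
Variable W : nat -> 'I_theta -> Omega -> 'rV[nat]_theta.

Lemma prob_ge0 E : 0 <= prob Pr E.
Proof. by rewrite fine_ge0. Qed.

Lemma probE E : measurable E -> (prob Pr E)%:E = Pr E.
Proof. by move=> mE; rewrite fineK// fin_num_measure. Qed.

Lemma multinomial_coef_ge0 a b (x : 'M[nat]_(a, b)) : 0 <= multinomial_coef R x.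
Proof. by rewrite divr_ge0. Qed.

Lemma gw_rec_ge0 n l t T : 0 <= gw_rec Pr W n l t T.
Proof.
elim: n l t T => [|n IH] l t T /=; first by case: ifP.
case: ifP => // _; rewrite mulr_ge0 ?prodr_ge0//.
by rewrite divr_ge0 ?prob_ge0 ?multinomial_coef_ge0.
Qed.

(** All these trees have the same offspring vector $w$, so $P(W=w)/D(w)$ factors out of the sum over
    lists of children. In $D(c)/D(w)$ the factorial of the number of children cancels. The classes
    are later taken to be the root types, then the typed cells. *)
Lemma esum_gw_children (K : finType) (V : K -> set (tree theta))
    (tau : K -> 'I_theta) (p : K -> R) (c : K -> nat) n l t :
  trivIset [set: K] V -> (forall a T, V a T -> root_type T = tau a) ->
  (forall a, \esum_(T in V a) (gw_rec Pr W n l.+1 (tau a) T)%:E = (p a)%:E)%E ->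
  let w := \row_s (\sum_(a | tau a == s) c a)%N in
  (\esum_(T in [set T | root_type T = t /\ lists_of_class_count V c (children T)])
     (gw_rec Pr W n.+1 l t T)%:E =
   (prob Pr (W l t @^-1` [set w]) *
    ((\prod_s (w ord0 s)`!)%:R / (\prod_a (c a)`!)%:R * \prod_a p a ^+ c a))%:E)%E.
Proof.
move=> Vtriv Vtau pE w.
rewrite (reindex_esum (lists_of_class_count V c) _ (Node t)); last first.
  split => [ts //|ts ts' _ _ []//|[t' ts] /= [-> cts]]; by exists ts.
pose g T := gw_rec Pr W n l.+1 (root_type T) T.
pose k := prob Pr (W l t @^-1` [set w]) / multinomial_coef R w.
transitivity (\esum_(ts in lists_of_class_count V c) (k%:E * (\prod_(T <- ts) g T)%:E))%E.
  apply: eq_esum => ts cts; rewrite -EFinM /= eqxx.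
  suff -> : offspring (Node t ts) = w by [].
  by apply/rowP => s; rewrite !mxE; exact: count_root_type cts.
have g0 T : 0 <= g T by exact: gw_rec_ge0.
rewrite esumZl; first last.
- by move=> ts; rewrite lee_fin prodr_ge0.
- by rewrite divr_ge0 ?prob_ge0 ?multinomial_coef_ge0.
rewrite (esum_lists_of_class_count Vtriv (p := p))//; last first.
  by move=> a; rewrite -pE; apply: eq_esum => T /Vtau; rewrite /g => ->.
rewrite -EFinM; congr EFin; rewrite /k multinomial_coef_row.
have -> : (\sum_s w ord0 s = \sum_a c a)%N.
  rewrite [RHS](partition_big tau predT)//=; apply: eq_bigr => s _.
  by rewrite mxE.
have S0 := natr_fact_neq0 R (\sum_a c a).
have c0 := natr_prod_fact_neq0 R c.
have w0 := natr_prod_fact_neq0 R (w ord0).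
by field; rewrite S0 c0 w0.
Qed.

Hypothesis mW : forall l t w, measurable (W l t @^-1` [set w]).

(** Induction on the height: the trees with offspring vector $w$ have mass at most $P(W=w)$, and
    these probabilities sum to 1. The bound already gives the finiteness that later steps use. *)
Lemma esum_gw_le1 n l t (S : set (tree theta)) :
  (\esum_(T in S) (gw_rec Pr W n l t T)%:E <= 1)%E.
Proof.
elim: n l t S => [|n IH] l t S;
    apply: (@le_trans _ _ (\esum_(T in setT) (gw_rec Pr W _ l t T)%:E)%E);
    try by apply: le_esum_subset => // T; rewrite lee_fin gw_rec_ge0.
  rewrite (_ : esum _ _ = \esum_(T in [set Node t [::]]) 1%:E)%E.
    by rewrite esum_set1 ?lee_fin.
  rewrite [RHS]esum_mkcond; apply: eq_esum => T _ /=.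
  case: eqP => [->|TN]; first by rewrite mem_set.
  by rewrite memNset.
(* The weight vanishes off root type [t], so the sum over all trees may be restricted to that type
   and then split by offspring vector. *)
rewrite (_ : esum _ _ =
    \esum_(T in trees_of_type t `&` (@offspring theta) @^-1` setT)
      (gw_rec Pr W n.+1 l t T)%:E)%E; last first.
  rewrite preimage_setT setIT [RHS]esum_mkcond; apply: eq_esum => T _ /=.
  by rewrite mem_trees_of_type; case: ifP.
rewrite esum_fibers; last by move=> T _; rewrite lee_fin gw_rec_ge0.
apply: (@le_trans _ _ (\esum_(w in [set: 'rV[nat]_theta])
  Pr (setT `&` W l t @^-1` [set w])))%E; last first.
  rewrite -measure_preimage_esum//.
  by rewrite setTI preimage_setT; exact: (probability_le1 Pr measurableT).
apply: le_esum => w _.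
pose p s := fine (\esum_(T in trees_of_type s) (gw_rec Pr W n l.+1 s T)%:E)%E.
have p0 s : 0 <= p s by rewrite fine_ge0// esum_ge0// => T _; rewrite lee_fin gw_rec_ge0.
have pE s : (\esum_(T in trees_of_type s) (gw_rec Pr W n l.+1 s T)%:E = (p s)%:E)%E.
  rewrite fineK// ge0_fin_numE.
    exact: le_lt_trans (IH _ _ _) (ltry _).
  by rewrite esum_ge0// => T _; rewrite lee_fin gw_rec_ge0.
have -> : trees_of_type t `&` (@offspring theta) @^-1` [set w] =
    [set T | root_type T = t /\
       lists_of_class_count (@trees_of_type theta) (w ord0) (children T)].
  have cE s ts : count (fun u => u \in trees_of_type s) ts =
      count (fun u : tree theta => root_type u == s) ts.
    by apply: eq_count => u; rewrite mem_trees_of_type.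
  apply/seteqP; split => T /= [Tt].
    move=> <-; split => //; split => [T' _|s]; first by exists (root_type T').
    by rewrite mxE cE.
  by move=> [_ cw]; split => //; apply/rowP => s; rewrite mxE -cE cw.
rewrite (esum_gw_children (tau := id) (p := p))//.
- rewrite (_ : \row_s _ = w); last by apply/rowP => s; rewrite mxE big_pred1_eq.
  rewrite setTI -probE// lee_fin ler_piMr ?prob_ge0//.
  (* With the root types as classes the counts are $w$ itself, so the factorials cancel; each $p_s$
     is at most 1 by induction. *)
  rewrite divff ?natr_prod_fact_neq0// mul1r prodr_ile1// => s _.
  rewrite exprn_ge0// exprn_ile1//.
  by rewrite -lee_fin -pE.
- by move=> s s' _ _ [T [/= <- <-]].
Qed.

(** The sum is finite, so [fine] does not replace it by a default value. *)
Lemma esum_gwE n l t (S : set (tree theta)) :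
  (\esum_(T in S) (gw_rec Pr W n l t T)%:E =
   (fine (\esum_(T in S) (gw_rec Pr W n l t T)%:E))%:E)%E.
Proof.
rewrite fineK// ge0_fin_numE.
  exact: le_lt_trans (esum_gw_le1 _ _ _ _) (ltry _).
by rewrite esum_ge0// => T _; rewrite lee_fin gw_rec_ge0.
Qed.

End GaltonWatsonMass.

(** * Law of the counting matrix *)

Definition col_sums a b (c : 'M[nat]_(a, b)) : 'rV[nat]_b := \row_j (\sum_i c i j)%N.

(** Taking the column sums as sizes makes every size test in [multinomial_pmf] succeed. The
    right-hand side has the form produced by [esum_gw_children] for the classes $(i,j)$. *)
Lemma prod_multinomial_pmf (R : realType) m theta (q : 'I_theta -> 'I_m -> R)
    (c : 'M[nat]_(m, theta)) :
  \prod_j multinomial_pmf (col_sums c ord0 j) (q j) (col j c) =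
  (\prod_j (col_sums c ord0 j)`!)%:R / (\prod_(a : 'I_m * 'I_theta) (c a.1 a.2)`!)%:R
  * \prod_(a : 'I_m * 'I_theta) q a.2 a.1 ^+ c a.1 a.2.
Proof.
rewrite -(pair_bigA _ (fun i j => (c i j)`!)) -(pair_bigA _ (fun i j => q j i ^+ c i j))/=.
rewrite exchange_big [X in _ * X]exchange_big/= !natr_prod -prodf_div -big_split/=.
apply: eq_bigr => j _; rewrite /multinomial_pmf mxE.
have cE i : col j c i ord0 = c i j by rewrite mxE.
have sumE : ((\sum_i col j c i ord0) = (\sum_i c i j))%N
  by apply: eq_bigr => i _; rewrite cE.
rewrite sumE eqxx /multinomial_coef; congr (_%:R / _ * _).
- by congr (_`!); apply: eq_bigr => i _; rewrite big_ord1 cE.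
- by congr (_%:R); apply: eq_bigr => i _; rewrite big_ord1 cE.
- by apply: eq_bigr => i _; rewrite cE.
Qed.

Section ConditionallyMultinomial.
Context (R : realType) (d : measure_display) (Omega : measurableType d).
Variables (Pr : probability Omega R) (m theta : nat).
Variables (W : Omega -> 'rV[nat]_theta) (X : Omega -> 'M[nat]_(m, theta)).
Variable q : 'I_theta -> 'I_m -> R.
Hypothesis mW : forall w, measurable (W @^-1` [set w]).
Hypothesis mX : forall c, measurable (X @^-1` [set c]).
Hypothesis XW : cond_multinomial_columns Pr W X q.

Lemma cprob_multinomial_columns w c : prob Pr (W @^-1` [set w]) != 0 ->
  cprob Pr (X @^-1` [set c]) (W @^-1` [set w]) =
  \prod_j multinomial_pmf (w ord0 j) (q j) (col j c).
Proof.
move=> Ww; have [indep law] := XW Ww.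
(* Independence is stated over finite index sets; here it is applied to all the columns at once. *)
pose J : {fset 'I_theta} := [fset j in index_enum 'I_theta]%fset.
have JE j : j \in J by rewrite in_fset mem_index_enum.
have -> : X @^-1` [set c] =
    \bigcap_(j in [set` J]) (fun om => col j (X om)) @^-1` [set col j c].
  apply/seteqP; split => [om /= Xc j _|om cols]; first by rewrite /= Xc.
  apply/matrixP => i j.
  by have /(congr1 (fun v : 'cV_m => v i ord0)) := cols j (JE j); rewrite !mxE.
rewrite indep (perm_big (index_enum 'I_theta)); last first.
  apply: uniq_perm; rewrite ?fset_uniq ?index_enum_uniq// => j.
  by rewrite JE mem_index_enum.
by apply: eq_bigr => j _; exact: law.
Qed.

(** Decomposing over the values $w$ of [W], only $w$ equal to the column sums of [c] contributes. *)
Lemma prob_multinomial_columns c :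
  prob Pr (X @^-1` [set c]) = prob Pr (W @^-1` [set col_sums c]) *
    \prod_j multinomial_pmf (col_sums c ord0 j) (q j) (col j c).
Proof.
(* This includes the null values of [W], for which both sides are 0. *)
have joint w : prob Pr (X @^-1` [set c] `&` W @^-1` [set w]) =
    prob Pr (W @^-1` [set w]) * \prod_j multinomial_pmf (w ord0 j) (q j) (col j c).
  have [Ww0|Ww0] := eqVneq (prob Pr (W @^-1` [set w])) 0.
    rewrite Ww0 mul0r; apply/eqP; rewrite eq_le prob_ge0 andbT -Ww0 -lee_fin !probE//.
      by rewrite le_measure ?inE//; exact: measurableI.
    exact: measurableI.
  by rewrite -cprob_multinomial_columns// mulrC divfK.
rewrite -joint; apply: EFin_inj; rewrite !probE//; last exact: measurableI.
rewrite -[X in Pr X = _]setIT -(preimage_setT W) measure_preimage_esum//.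
rewrite -[RHS](esum_set1 (a := fun w => Pr (X @^-1` [set c] `&` W @^-1` [set w])))//.
rewrite [RHS]esum_mkcond; apply: eq_esum => w _.
case: ifPn => //; rewrite notin_setE/= => wc.
rewrite -probE; last exact: measurableI.
congr EFin; rewrite joint.
(* A column whose sum differs from $w_j$ has multinomial mass 0. *)
suff [j wj] : exists j, w ord0 j != col_sums c ord0 j.
  rewrite (bigD1 j)//= {1}/multinomial_pmf ifN ?mul0r ?mulr0//.
  move: wj; rewrite eq_sym mxE; congr (_ != _).
  by apply: eq_bigr => i _; rewrite mxE.
apply/existsP; rewrite -negb_forall; apply/negP => /forallP wE.
by apply: wc; apply/rowP => j; apply/eqP.
Qed.

End ConditionallyMultinomial.

(** * Cells of the recursive partition and their masses *)

Section Cells.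
Context (theta m k0 : nat) (A : 'I_m -> set (tree theta)).
Variable B : nat -> 'I_m -> set 'M[nat]_(m, theta).
Hypothesis A_partition : is_partition A (trees_le k0).

(** No induction is involved: above level 0 the cells are the preimages of the parts of $B$ under
    one counting map. *)
Lemma cell_rec_partition n :
  ((0 < n)%N -> is_partition (B (k0 + n)) setT) ->
  is_partition (cell_rec k0 A B n) (trees_le (k0 + n)).
Proof.
case: n => [_|n /(_ isT) [Btriv Bcover]]; first by rewrite addn0.
split => [i j _ _ [T [[_ iT] [_ jT]]]|].
  by apply: Btriv => //; exists (count_mx (cell_rec k0 A B n) T).
apply/seteqP; split => [T [i _ []//]|T leT].
have [i _ iT] : (\bigcup_i B (k0 + n.+1) i) (count_mx (cell_rec k0 A B n) T).
  by rewrite Bcover.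
by exists i.
Qed.

(** The class counted by one entry of the counting matrix, with index [a] = (cell, root type). *)
Definition typed_cell n (a : 'I_m * 'I_theta) : set (tree theta) :=
  cell_rec k0 A B n a.1 `&` trees_of_type a.2.

Variable n : nat.
Hypothesis Bn_partition : (0 < n)%N -> is_partition (B (k0 + n)) setT.

Lemma typed_cell_trivIset : trivIset [set: 'I_m * 'I_theta] (typed_cell n).
Proof.
move=> [i s] [j t] _ _ [T [[/= iT sT] [/= jT tT]]].
congr pair; last by rewrite -sT -tT.
by apply: (cell_rec_partition Bn_partition).1 => //; exists T.
Qed.

Lemma trees_le_cellP T : trees_le (k0 + n) T <-> exists i, cell_rec k0 A B n i T.
Proof.
rewrite -(cell_rec_partition Bn_partition).2.
by split => [[i _ iT]|[i iT]]; exists i.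
Qed.

Lemma trees_le_typed_cellP T : trees_le (k0 + n.+1) T <->
  {in children T, forall T', exists a, typed_cell n a T'}.
Proof.
case: T => t ts /=; rewrite addnS trees_le_Node.
split => le_ts T' /le_ts.
  by move=> /trees_le_cellP[i iT']; exists (i, root_type T').
by case=> [[i s]] [iT' _]; apply/trees_le_cellP; exists i.
Qed.

Lemma count_mx_typed_cell T : trees_le (k0 + n.+1) T ->
  lists_of_class_count (typed_cell n)
    (fun a => count_mx (cell_rec k0 A B n) T a.1 a.2) (children T).
Proof. by move=> /trees_le_typed_cellP le_T; split => // a; rewrite mxE. Qed.

Lemma offspring_count_mx T : trees_le (k0 + n.+1) T ->
  offspring T = col_sums (count_mx (cell_rec k0 A B n) T).
Proof.
move=> /count_mx_typed_cell cT; apply/rowP => s; rewrite !mxE.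
rewrite (count_root_type (tau := snd) _ typed_cell_trivIset _ cT); last by move=> a T' [].
rewrite -(pair_big_dep predT (fun _ s' => s' == s)
  (fun i s' => count_mx (cell_rec k0 A B n) T i s'))/=.
by apply: eq_bigr => i _; rewrite big_pred1_eq.
Qed.

Context (R : realType) (d : measure_display) (Omega : measurableType d).
Variables (Pr : probability Omega R) (W : nat -> 'I_theta -> Omega -> 'rV[nat]_theta).
Hypothesis mW : forall l t w, measurable (W l t @^-1` [set w]).

(** This is [cell_prob] for $k=k_0+n'+l$, indexed by the number of levels above $k_0$ so that
    induction needs no subtraction. *)
Definition cell_mass l (t : 'I_theta) n' (i : 'I_m) : R :=
  fine (\esum_(T in cell_rec k0 A B n' i `&` trees_of_type t)
    (gw_rec Pr W (k0 + n') l t T)%:E)%E.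

(** Splitting the cell by the value $c$ of the counting matrix, each fibre has mass $P(X=c)$: both
    sides are given by the same product formula. *)
Lemma cell_mass_preimage l t (X : Omega -> 'M[nat]_(m, theta)) i :
  (forall c, measurable (X @^-1` [set c])) ->
  cond_multinomial_columns Pr (W l t) X (fun j i => cell_mass l.+1 j n i) ->
  cell_mass l t n.+1 i = prob Pr (X @^-1` B (k0 + n.+1) i).
Proof.
move=> mX XW; congr fine.
pose D := [set T | root_type T = t] `&` trees_le (k0 + n.+1).
have -> : cell_rec k0 A B n.+1 i `&` trees_of_type t =
    D `&` count_mx (cell_rec k0 A B n) @^-1` B (k0 + n.+1) i.
  by apply/seteqP; split => T; [move=> [[? ?] ?]|move=> [[? ?] ?]].
rewrite esum_fibers; last by move=> T _; rewrite lee_fin gw_rec_ge0.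
rewrite -[X in Pr X]setTI measure_preimage_esum//.
apply: eq_esum => c _; transitivity (Pr (X @^-1` [set c])); last by rewrite setTI.
rewrite -probE//.
rewrite (prob_multinomial_columns (mW l t) mX XW) prod_multinomial_pmf.
(* The height bound in [D] amounts to every child lying in some typed cell. *)
have -> : D `&` count_mx (cell_rec k0 A B n) @^-1` [set c] =
    [set T | root_type T = t /\
       lists_of_class_count (typed_cell n) (fun a => c a.1 a.2) (children T)].
  apply/seteqP; split => T /=.
    by move=> [[Tt leT] <-]; split=> //; exact: count_mx_typed_cell.
  move=> [Tt [leT cT]]; split; first by split => //; apply/trees_le_typed_cellP.
  by apply/matrixP => j s; rewrite mxE -(cT (j, s)).
rewrite addnS (esum_gw_children (tau := snd) (p := fun a => cell_mass l.+1 a.2 n a.1)) //.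
- suff -> : \row_s (\sum_(a : 'I_m * 'I_theta | a.2 == s) c a.1 a.2)%N = col_sums c by [].
  apply/rowP => s; rewrite !mxE.
  rewrite -(pair_big_dep predT (fun _ s' => s' == s) (fun i s' => c i s'))/=.
  by apply: eq_bigr => j _; rewrite big_pred1_eq.
- exact: typed_cell_trivIset.
- by move=> a T [].
- by move=> a; rewrite -esum_gwE.
Qed.
End Cells.

(** * Factorization of the Galton-Watson weight through the cell of the tree *)

Section Decomposition.
Context (R : realType) (theta m k0 k : nat).
Variable A : 'I_m -> set (tree theta).
Hypothesis A_partition : is_partition A (trees_le k0).
Variable B : nat -> 'I_m -> set 'M[nat]_(m, theta).
Hypothesis B_partition : forall l, (k0 < l <= k)%N -> is_partition (B l) setT.
Context (d : measure_display) (Omega : measurableType d) (Pr : probability Omega R).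
Variable W : nat -> 'I_theta -> Omega -> 'rV[nat]_theta.
Hypothesis mW : forall l t w, measurable (W l t @^-1` [set w]).
Variable X : nat -> 'I_theta -> Omega -> 'M[nat]_(m, theta).
Hypothesis mX : forall l t S, measurable (X l t @^-1` S).
Hypothesis XW : forall l t, (l < k - k0)%N ->
  cond_multinomial_columns Pr (W l t) (X l t)
    (fun j i => cell_prob Pr W k0 k A B l.+1 j i).

Lemma cell_probE n l t i : (k = k0 + n + l)%N ->
  cell_prob Pr W k0 k A B l t i = cell_mass k0 A B Pr W l t n i.
Proof. by move=> ->; rewrite /cell_prob /gw_measure /gw /cell addnK addKn. Qed.

(** Above level 0, a tree outside cell [i] has counting matrix outside the part $B_i$, so the
    conditioned event is empty. *)
Lemma tildeQ_rec0 n l t i T : (k = k0 + n + l)%N -> trees_le (k0 + n) T ->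
  ~ cell_rec k0 A B n i T -> tildeQ_rec Pr W k0 k A B X n l t i T = 0.
Proof.
case: n => [|n] kE leT iT /=; first by rewrite memNset.
have kl : (k - l = k0 + n.+1)%N by lia.
have cellE : cell k0 A B (k0 + n.+1).-1 = cell_rec k0 A B n.
  by rewrite /cell addnS /= addKn.
rewrite /counting kl cellE /cprob.
rewrite (_ : _ `&` _ = set0) ?/prob ?measure0 ?mul0r//.
by apply/seteqP; split => // om [/= -> BT]; apply: iT.
Qed.

(** Induction on the number of levels above $k_0$, with the children handled at level [l.+1]. *)
Lemma gw_cell n l t i T : (k = k0 + n + l)%N -> typed_cell k0 A B n (i, t) T ->
  gw_rec Pr W (k0 + n) l t T =
  cell_prob Pr W k0 k A B l t i * tildeQ_rec Pr W k0 k A B X n l t i T.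
Proof.
elim: n l t i T => [|n IH] l t i T kE [/= iT tT].
  rewrite (cell_probE _ _ kE) mem_set// /gw_measure /gw.
  have -> : (k - l = k0 + 0)%N by lia.
  rewrite -/(cell_mass k0 A B Pr W l t 0 i).
  (* In a null cell the weight of [T] is 0 by monotonicity, so the identity survives the division by
     0. *)
  have [M0|M0] := eqVneq (cell_mass k0 A B Pr W l t 0 i) 0; last by rewrite mulrC divfK.
  rewrite M0 mul0r; apply/eqP; rewrite eq_le gw_rec_ge0 andbT -M0 -lee_fin.
  rewrite /cell_mass -esum_gwE//.
  rewrite -[leLHS](esum_set1 (a := fun T => (gw_rec Pr W (k0 + 0) l t T)%:E))
    ?lee_fin ?gw_rec_ge0//.
  apply: le_esum_subset => [_ -> //|T']; by rewrite lee_fin gw_rec_ge0.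
have kl : (k - l = k0 + n.+1)%N by lia.
have kE' : (k = k0 + n + l.+1)%N by lia.
have cellE : cell k0 A B (k0 + n.+1).-1 = cell_rec k0 A B n.
  by rewrite /cell addnS /= addKn.
have lk : (l < k - k0)%N by lia.
have Bn_partition : (0 < n)%N -> is_partition (B (k0 + n)) setT.
  by move=> n0; apply: B_partition; lia.
have XWl : cond_multinomial_columns Pr (W l t) (X l t)
    (fun j i => cell_mass k0 A B Pr W l.+1 j n i).
  have := @XW l t lk; congr cond_multinomial_columns.
  by apply/funext => j; apply/funext => i'; rewrite (cell_probE _ _ kE').
have [leT BT] := iT.
rewrite /counting kl cellE (cell_probE _ _ kE).
rewrite (cell_mass_preimage A_partition Bn_partition mW i (fun c => mX l t [set c]) XWl).
set C := count_mx _ T.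
(* The cell mass, now $P(X\in B_i)$, cancels the denominator of the conditional probability. If it
   is 0, so is $P(X=C)$, because $C\in B_i$. *)
have pX : prob Pr (X l t @^-1` B (k0 + n.+1) i) *
    cprob Pr (X l t @^-1` [set C]) (X l t @^-1` B (k0 + n.+1) i) =
    prob Pr (X l t @^-1` [set C]).
  have CB : X l t @^-1` [set C] `<=` X l t @^-1` B (k0 + n.+1) i by move=> om /= ->.
  have mB : measurable (X l t @^-1` B (k0 + n.+1) i) by exact: mX.
  rewrite /cprob setIidl//.
  have [pB0|pB0] := eqVneq (prob Pr (X l t @^-1` B (k0 + n.+1) i)) 0; last first.
    by rewrite mulrC divfK.
  rewrite pB0 mul0r; apply/eqP; rewrite eq_le prob_ge0/= -pB0 -lee_fin !probE//.
  by rewrite le_measure ?inE.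
rewrite 2!mulrA pX (prob_multinomial_columns (mW l t) (fun c => mX l t [set c]) XWl).
rewrite prod_multinomial_pmf addnS /= tT eqxx.
rewrite (offspring_count_mx A_partition Bn_partition leT) -/C.
(* Each child lies in exactly one cell, and the induction hypothesis splits its weight into a cell
   mass and a conditional weight. Exactly [C j s] children carry the mass of index [(j, s)], whence
   the powers. *)
have prodE : \prod_(T' <- children T) gw_rec Pr W (k0 + n) l.+1 (root_type T') T' =
   \prod_(a : 'I_m * 'I_theta) cell_mass k0 A B Pr W l.+1 a.2 n a.1 ^+ C a.1 a.2 *
   \prod_(j < m) \prod_(T' <- children T | T' \in cell_rec k0 A B n j)
     tildeQ_rec Pr W k0 k A B X n l.+1 (root_type T') j T'.
  transitivity (\prod_(T' <- children T) \prod_(j | T' \in cell_rec k0 A B n j)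
      (cell_mass k0 A B Pr W l.+1 (root_type T') n j *
       tildeQ_rec Pr W k0 k A B X n l.+1 (root_type T') j T')).
    rewrite big_seq [RHS]big_seq; apply: eq_bigr => T' T'T.
    have [[j s] /= jT'] := (trees_le_typed_cellP A_partition Bn_partition T).1 leT T' T'T.
    have ts : root_type T' = s := jT'.2.
    rewrite (big_pred1 j) => [|j']; last first.
      exact: (mem_class (cell_rec_partition A_partition Bn_partition).1 _ jT'.1).
    by rewrite -(cell_probE _ _ kE'); apply: IH => //; rewrite ts.
  rewrite (exchange_big_dep predT)//=; under eq_bigr do rewrite big_split/=.
  rewrite big_split/=; congr (_ * _).
  rewrite -(pair_bigA _ (fun j s => cell_mass k0 A B Pr W l.+1 s n j ^+ C j s))/=.
  apply: eq_bigr => j _; rewrite (partition_big (@root_type theta) predT)//=.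
  apply: eq_bigr => s _; rewrite mxE.
  rewrite (eq_bigr (fun=> cell_mass k0 A B Pr W l.+1 s n j)) => [|T' /andP[_ /eqP->]//].
  rewrite big_const_seq iter_mulr_1; congr (_ ^+ _).
  by apply: eq_count => T'; rewrite in_setI mem_trees_of_type.
rewrite prodE multinomial_coef_row /multinomial_coef.
rewrite (pair_bigA _ (fun i j => (C i j)`!)) (pair_bigA _ (fun i j => C i j))/=.
(* $D(N)$ and $D(C)$ share the same numerator; the remaining identity only involves nonzero
   factorials. *)
have -> : (\sum_s col_sums C ord0 s = \sum_(a : 'I_m * 'I_theta) C a.1 a.2)%N.
  rewrite -(pair_bigA _ (fun i j => C i j)) exchange_big/=.
  by apply: eq_bigr => s _; rewrite mxE.
have S0 := natr_fact_neq0 R (\sum_(a : 'I_m * 'I_theta) C a.1 a.2).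
have c0 := natr_prod_fact_neq0 R (fun a : 'I_m * 'I_theta => C a.1 a.2).
have w0 := natr_prod_fact_neq0 R (col_sums C ord0).
by field; rewrite S0 c0 w0.
Qed.

End Decomposition.

Theorem theorem1 (R : realType) (theta m : nat) (theta_ge1 : (1 <= theta)%N)
  (m_ge1 : (1 <= m)%N)
  (mu : nat -> 'I_theta -> probability 'rV[nat]_theta R)
  (k0 k : nat) (k_ge1 : (1 <= k)%N) (k0_le_k : (k0 <= k)%N)
  (A : 'I_m -> set (tree theta)) (A_partition : is_partition A (trees_le k0))
  (B : nat -> 'I_m -> set 'M[nat]_(m, theta))
  (B_partition : forall l, (k0 < l <= k)%N -> is_partition (B l) [set: 'M[nat]_(m, theta)])
  (d : measure_display) (Omega : measurableType d) (Pr : probability Omega R)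
  (W : nat -> 'I_theta -> {RV Pr >-> 'rV[nat]_theta})
  (W_law : forall l t (S : set 'rV[nat]_theta), distribution Pr (W l t) S = mu l t S)
  (W_indep : mutually_independent (prob Pr)
     (fun lt : (nat * 'I_theta)%type => W lt.1 lt.2 : Omega -> 'rV[nat]_theta))
  (X : nat -> 'I_theta -> {RV Pr >-> 'M[nat]_(m, theta)})
  (X_law : forall l t, (l < k - k0)%N ->
     cond_multinomial_columns Pr (W l t) (X l t)
       (fun j i => cell_prob Pr W k0 k A B l.+1 j i))
  (l : nat) (l_le : (l <= k - k0)%N) (t : 'I_theta)
  (T : tree theta) (T_in : (trees_le (k - l) `&` trees_of_type t) T) :
  gw Pr W l k t T = tildeP Pr W k0 k A B X l t T.
Proof.
have [leT tT] := T_in.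
have mW j s w : measurable ((W j s : Omega -> _) @^-1` [set w]).
  by rewrite -[X in measurable X]setTI; exact: measurable_funPT.
have mX j s S : measurable ((X j s : Omega -> _) @^-1` S).
  by rewrite -[X in measurable X]setTI; exact: measurable_funPT.
pose n := (k - k0 - l)%N.
have kE : (k = k0 + n + l)%N by rewrite /n; lia.
have kl : (k - l = k0 + n)%N by lia.
have Bn_partition : (0 < n)%N -> is_partition (B (k0 + n)) setT.
  by move=> n0; apply: B_partition; lia.
rewrite kl in leT.
have [i iT] := (trees_le_cellP A_partition Bn_partition T).1 leT.
(* Only the unique cell containing [T] contributes to the sum defining [tildeP]. *)
rewrite /tildeP /tildeQ -/n (bigD1 i)//= big1 ?addr0.
  rewrite /gw kl.
  exact: (gw_cell A_partition B_partition mW mX X_law).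
move=> j ji; rewrite (tildeQ_rec0 Pr W X t kE leT) ?mulr0// => jT.
have /eqP[] := ji.
by apply: (cell_rec_partition A_partition Bn_partition).1 => //; exists T.
Qed.
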